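(* Let $q$ be a finite binary sequence containing exactly $r$ entries equal to $1$, and let $1(i)$ denote the position of the $i$-th occurrence of the digit $1$ in $q$ ($i=1,\dots,r$). Then $$\sum_{i=1}^r 3^{r-i}\cdot 2^{1(i)-1}\;\geq\; 3^{r}-2^{r},$$ and equality holds when $1(i)=i$ for all $i=1,\dots,r$.
   Context: Positions in a binary sequence $q$ of length $s$ are numbered $1,2,\dots,s$ from left to right. For example, for $q=1110110100$ one has $r=6$ and $1(1)=1$, $1(2)=2$, $1(3)=3$, $1(4)=5$, $1(5)=6$, $1(6)=8$. *)

(* Defs.v *)
From mathcomp Require Import all_boot all_order all_algebra.

Set Implicit Arguments.
Unset Strict Implicit.
Unset Printing Implicit Defensive.

(* Positions are numbered from 1, whereas [nth] indexes from 0. *)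
Definition ones_positions (q : bitseq) : seq nat :=
  [seq p <- iota 1 (size q) | nth false q p.-1].

(* 1(i): also the occurrences are counted from 1. The result is meaningful only
   for 1 <= i <= count_mem true q (elsewhere it is a junk value). *)
Definition one_pos (q : bitseq) (i : nat) : nat :=
  nth 0 (ones_positions q) i.-1.

Example one_pos_1110110100 :
  let q := [:: true; true; true; false; true; true; false; true; false; false] in
  count_mem true q = 6 /\
  [seq one_pos q i | i <- iota 1 6] = [:: 1; 2; 3; 5; 6; 8].
Proof. by []. Qed.

(* Main.v *)
Require Import Defs.
From mathcomp Require Import all_boot all_order all_algebra.

Set Implicit Arguments.
Unset Strict Implicit.
Unset Printing Implicit Defensive.

Import Order.TTheory GRing.Theory Num.Theory.
Local Open Scope ring_scope.

(** The positions of the ones form a strictly increasing sequence of positive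
    integers, so the [i]-th of them is at least [i] ([leq_one_pos]). Replacing
    each position by this lower bound does not increase any term, and what
    remains is the geometric sum of the [3 ^ (r - i) * 2 ^ (i - 1)], which
    telescopes to [3 ^ r - 2 ^ r] because [3 - 2 = 1] ([sum_pow3_pow2]). The
    replacement changes nothing when every position already equals its index,
    which is the case of equality. *)

Lemma size_ones_positions (q : bitseq) :
  size (ones_positions q) = count_mem true q.
Proof.
rewrite size_filter -[1%N]addn0 iotaDl count_map.
rewrite -[in RHS](mkseq_nth false q) /mkseq count_map.
by apply: eq_count => p /=; rewrite eqb_id.
Qed.

Lemma path_ltn_nth (m i : nat) (s : seq nat) :
  path ltn m s -> (i < size s)%N -> (m + i < nth 0 s i)%N.
Proof.
elim: s m i => [|x s IHs] m [|i] //= /andP[lt_mx path_s] lt_is.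
  by rewrite addn0.
by apply: leq_ltn_trans (IHs x i path_s lt_is); rewrite addnS -addSn leq_add2r.
Qed.

Lemma leq_one_pos (q : bitseq) (i : nat) :
  (1 <= i <= count_mem true q)%N -> (i <= one_pos q i)%N.
Proof.
case: i => [//|i] /= le_ir.
(* Positions start at 1, so 0 can be put in front of them. *)
have path_q : path ltn 0 (ones_positions q).
  rewrite path_min_sorted.
    by apply: sorted_filter (iota_ltn_sorted _ _) => ? ? ?; apply: ltn_trans.
  by apply/allP => p; rewrite mem_filter mem_iota => /and3P[].
by apply: (path_ltn_nth path_q); rewrite size_ones_positions.
Qed.

Lemma sum_pow3_pow2 (r : nat) :
  \sum_(1 <= i < r.+1) (3%:Z ^+ (r - i)%N * 2%:Z ^+ (i - 1)%N)
    = 3%:Z ^+ r - 2%:Z ^+ r.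
Proof.
rewrite subrXX (_ : 3%:Z - 2%:Z = 1) // mul1r big_add1 big_mkord.
by apply: eq_bigr => i _; rewrite subn1 subnS predn_sub.
Qed.

Theorem theorem2p3 (q : bitseq) (r : nat) (hr : count_mem true q = r) :
  (\sum_(1 <= i < r.+1) (3%:Z ^+ (r - i)%N * 2%:Z ^+ (one_pos q i - 1)%N)
     >= 3%:Z ^+ r - 2%:Z ^+ r)
  /\
  ((forall i : nat, (1 <= i <= r)%N -> one_pos q i = i) ->
   \sum_(1 <= i < r.+1) (3%:Z ^+ (r - i)%N * 2%:Z ^+ (one_pos q i - 1)%N)
     = 3%:Z ^+ r - 2%:Z ^+ r).
Proof.
rewrite -sum_pow3_pow2; split=> [|pos_id]; last first.
  by apply: eq_big_nat => i le_ir; rewrite pos_id.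
rewrite big_nat [leRHS]big_nat; apply: ler_sum => i le_ir.
rewrite ler_wpM2l ?exprn_ge0 // ler_weXn2l // leq_sub2r //.
by apply: leq_one_pos; rewrite hr.
Qed.
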